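(* Let $F$ be an algebraically closed field of characteristic $0$ and let $(G,\beta)$ be a nontrivial finite nonsingular symplectic abelian group. Then: (1) $R^-=G\setminus\{0\}$ is a reduced and indecomposable skew root system of Lie type in $(G,\beta)$, and $L(R^-)\cong \mathfrak{sl}_n(F)$, where $|G|=n^2$. (2) $R^+=G$ is a reduced skew root system of Jordan type in $(G,\beta)$, and $J(R^+)\cong M_n(F)^+$, where $|G|=n^2$.
   Context: A symplectic abelian group $(G,\beta)$ is a finitely generated additive abelian group $G$ with an alternating bicharacter, i.e. a $\mathbb{Z}$-bilinear map $\beta:G\times G\to F^\times$ with $\beta(g,g)=1$ for all $g$. $\mathrm{Rad}(\beta)=\{g\in G:\beta(g,h)=1\ \forall h\in G\}$; $(G,\beta)$ is nonsingular if $\mathrm{Rad}(\beta)=0$. Subsets $A,B\subseteq G$ are orthogonal if $\beta(a,b)=1$ for all $a\in A,b\in B$. $R\subseteq G$ is a skew root system of Lie type in $(G,\beta)$ if $\mathrm{Rad}(\beta)\ne G$ and: $R\subseteq G\setminus\mathrm{Rad}(\beta)$ generates $G$; $R=-R$; and $a,b\in R$, $\beta(a,b)\ne1$ imply $a+b\in R$. $R\subseteq G$ (nonempty) is a skew root system of Jordan type in $(G,\beta)$ if: $R$ generates $G$; $R=-R$; and $a,b\in R$, $\beta(a,b)\neq-1$ imply $a+b\in R$. Either is reduced if $\mathrm{Rad}(\beta)=0$. A skew root system of Lie type is decomposable if $G$ is the orthogonal direct sum of two proper subgroups $G_1,G_2$, $R$ is the union of two orthogonal subsets $R_1,R_2$,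 and $R_i$ is a skew root system of Lie type in $(G_i,\beta|_{G_i\times G_i})$ for $i=1,2$; otherwise indecomposable. Choose a 2-cocycle $\xi\in Z^2(G,F^\times)$ with $\xi(a,b)\xi(b,a)^{-1}=\beta(a,b)$ (it exists; different choices give isomorphic graded algebras), and let $F^\xi G$ be the associative algebra with basis $\{u_g:g\in G\}$ and $u_au_b=\xi(a,b)u_{a+b}$. For $R$ of Lie type, $L(R)=\bigoplus_{a\in R}Fu_a$ with $[x,y]=xy-yx$; for $R$ of Jordan type, $J(R)=\bigoplus_{a\in R}Fu_a$ with $x\circ y=\frac12(xy+yx)$. For an associative algebra $A$, $A^+$ denotes $A$ with the Jordan product $x\circ y=\frac12(xy+yx)$. *)

(* Defs.v *)
From HB Require Import structures.
From mathcomp Require Import all_boot all_order all_fingroup all_algebra.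

Set Implicit Arguments.
Unset Strict Implicit.
Unset Printing Implicit Defensive.

Import GRing.Theory.
Local Open Scope ring_scope.

(* A [finZmodType] is canonically a [finGroupType] (with [+] as group law), so
   [{group G}], [<<R>>%g] and [\x] below are the subgroups, generated subgroup
   and internal direct sum of the additive group G. *)

Section SkewRootSystems.
Variables (F : fieldType) (G : finZmodType).
Implicit Types (beta : G -> G -> F) (H : {group G}) (R A B : {set G}).

Record alternating_bicharacter beta : Prop := AlternatingBicharacter {
  bichar_neq0 : forall a b, beta a b != 0;
  bicharDl : forall a b c, beta (a + b) c = beta a c * beta b c;
  bicharDr : forall a b c, beta a (b + c) = beta a b * beta a c;
  bichar_alt : forall a, beta a a = 1
}.

(* The notions for the pair (H, beta|_{H x H}), for a subgroup H of G; the pair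
   (G, beta) itself is the case H = [set: G]. *)
Definition radical beta H : {set G} :=
  [set g in H | [forall h in H, beta g h == 1]].

Definition nonsingular beta H : Prop := radical beta H = [set 0].

Definition orthogonal_sets beta A B : Prop :=
  forall a b, a \in A -> b \in B -> beta a b = 1.

Record skew_root_Lie beta H R : Prop := SkewRootLie {
  skewL_rad : radical beta H != H;
  skewL_sub : R \subset H :\: radical beta H;
  skewL_gen : <<R>>%g = H;
  skewL_opp : [set - a | a in R] = R;
  skewL_add : forall a b, a \in R -> b \in R -> beta a b != 1 -> a + b \in R
}.

Record skew_root_Jordan beta H R : Prop := SkewRootJordan {
  skewJ_neq0 : R != set0;
  skewJ_sub : R \subset H;
  skewJ_gen : <<R>>%g = H;
  skewJ_opp : [set - a | a in R] = R;
  skewJ_add : forall a b, a \in R -> b \in R -> beta a b != -1 -> a + b \in R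
}.

Definition reduced_skew_root_Lie beta H R : Prop :=
  skew_root_Lie beta H R /\ nonsingular beta H.

Definition reduced_skew_root_Jordan beta H R : Prop :=
  skew_root_Jordan beta H R /\ nonsingular beta H.

Definition decomposable_Lie beta H R : Prop :=
  exists (H1 H2 : {group G}) (R1 R2 : {set G}),
    [/\ (H1 \x H2)%g = H, H1 \proper H, H2 \proper H
      & orthogonal_sets beta H1 H2] /\
    [/\ R = R1 :|: R2, orthogonal_sets beta R1 R2,
        skew_root_Lie beta H1 R1 & skew_root_Lie beta H2 R2].

Definition indecomposable_skew_root_Lie beta H R : Prop :=
  skew_root_Lie beta H R /\ ~ decomposable_Lie beta H R.

End SkewRootSystems.

(* G acts trivially on F^x; the group law of F^x is multiplication in F, that
   of G is addition. *)
Record cocycle2 (F : fieldType) (G : finZmodType) := Cocycle2 {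
  cocycle_fun :> G -> G -> F;
  cocycle_neq0 : forall a b, cocycle_fun a b != 0;
  cocycleP : forall a b c,
    cocycle_fun a b * cocycle_fun (a + b) c =
    cocycle_fun b c * cocycle_fun a (b + c)
}.

Definition cocycle_induces (F : fieldType) (G : finZmodType)
    (xi : cocycle2 F G) (beta : G -> G -> F) : Prop :=
  forall a b, xi a b * (xi b a)^-1 = beta a b.

(* The twisted group algebra F^xi G: the function x stands for
   \sum_a x a *: u_a. *)
Definition twisted_group_algebra (F : fieldType) (G : finZmodType)
  (xi : cocycle2 F G) : Type := {ffun G -> F^o}.

Section TwistedGroupAlgebra.
Variables (F : fieldType) (G : finZmodType) (xi : cocycle2 F G).
Local Notation A := (twisted_group_algebra xi).

HB.instance Definition _ := Vector.copy A {ffun G -> F^o}.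

Definition tw_basis (g : G) : A := [ffun h => (h == g)%:R].

Definition tw_one : A := (xi 0 0)^-1 *: tw_basis 0.

Definition tw_mul (x y : A) : A :=
  [ffun c => \sum_(a : G) x a * y (c - a) * xi a (c - a)].

Lemma tw_cocycle0l b : xi 0 b = xi 0 0.
Proof.
have := cocycleP xi 0 0 b; rewrite !add0r => /(mulIf (cocycle_neq0 _ _ _)).
by move=> <-.
Qed.

Lemma tw_cocycle0r a : xi a 0 = xi 0 0.
Proof.
have := cocycleP xi a 0 0; rewrite !addr0 => /(mulIf (cocycle_neq0 _ _ _)).
by move=> <-.
Qed.

Lemma tw_mulA : associative tw_mul.
Proof.
move=> x y z; apply/ffunP => c; rewrite !ffunE.
under eq_bigr => a _ do rewrite ffunE mulr_sumr mulr_suml.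
under [RHS]eq_bigr => d _ do rewrite ffunE !mulr_suml.
rewrite [RHS]exchange_big /=; apply: eq_bigr => a _.
rewrite [RHS](reindex_inj (addrI a)) /=; apply: eq_bigr => b _.
have -> : a + b - a = b by rewrite addrC addKr.
rewrite opprD addrA.
have := cocycleP xi a b (c - a - b).
rewrite [b + _]addrC subrK => e.
rewrite -!mulrA -e; congr (_ * (_ * _)).
by rewrite mulrCA.
Qed.

Lemma tw_mul1 : left_id tw_one tw_mul.
Proof.
move=> x; apply/ffunP => c; rewrite !ffunE (bigD1 0) //= big1 => [|a a0].
  rewrite !ffunE eqxx subr0 addr0 tw_cocycle0l /GRing.scale /= mulr1.
  by rewrite mulrAC mulVf ?mul1r ?cocycle_neq0.
by rewrite !ffunE (negbTE a0) scaler0 !mul0r.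
Qed.

Lemma tw_mulr1 : right_id tw_one tw_mul.
Proof.
move=> x; apply/ffunP => c; rewrite !ffunE (bigD1 c) //= big1 => [|a ac].
  rewrite !ffunE subrr eqxx addr0 tw_cocycle0r /GRing.scale /= mulr1.
  by rewrite -mulrA mulVf ?mulr1 ?cocycle_neq0.
by rewrite !ffunE subr_eq0 eq_sym (negbTE ac) scaler0 mulr0 mul0r.
Qed.

Lemma tw_mulDl : left_distributive tw_mul +%R.
Proof.
move=> x y z; apply/ffunP => c; rewrite !ffunE -big_split /=.
by apply: eq_bigr => a _; rewrite !ffunE !mulrDl.
Qed.

Lemma tw_mulDr : right_distributive tw_mul +%R.
Proof.
move=> x y z; apply/ffunP => c; rewrite !ffunE -big_split /=.
by apply: eq_bigr => a _; rewrite !ffunE mulrDr mulrDl.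
Qed.

Lemma tw_one_neq0 : tw_one != 0.
Proof.
apply/eqP => /ffunP /(_ 0); rewrite !ffunE eqxx.
rewrite /GRing.scale /= mulr1 => /eqP; rewrite invr_eq0.
exact/negP/cocycle_neq0.
Qed.

HB.instance Definition _ := GRing.Zmodule_isNzRing.Build A
  tw_mulA tw_mul1 tw_mulr1 tw_mulDl tw_mulDr tw_one_neq0.

Lemma tw_scaleAl (k : F) (x y : A) : k *: (x * y) = (k *: x) * y.
Proof.
apply/ffunP => c; rewrite !ffunE /GRing.scale /= mulr_sumr.
by apply: eq_bigr => a _; rewrite !ffunE /GRing.scale /= !mulrA.
Qed.

Lemma tw_scaleAr (k : F) (x y : A) : k *: (x * y) = x * (k *: y).
Proof.
apply/ffunP => c; rewrite !ffunE /GRing.scale /= mulr_sumr.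
apply: eq_bigr => a _; rewrite !ffunE /GRing.scale /= !mulrA.
by rewrite [k * _]mulrC.
Qed.

HB.instance Definition _ := GRing.Lmodule_isLalgebra.Build F A tw_scaleAl.
HB.instance Definition _ := GRing.Lalgebra_isAlgebra.Build F A tw_scaleAr.

Lemma tw_basisM a b : tw_basis a * tw_basis b = xi a b *: tw_basis (a + b).
Proof.
apply/ffunP => c; rewrite !ffunE (bigD1 a) //= big1 => [|d da]; last first.
  by rewrite !ffunE (negbTE da) !mul0r.
rewrite !ffunE eqxx mul1r addr0 /GRing.scale /= subr_eq [b + a]addrC.
have [-> | _] := eqVneq c (a + b); last by rewrite mul0r mulr0.
by rewrite [a + b]addrC addrK mul1r mulr1.
Qed.

(* The common underlying space of L(R) and J(R). *)
Definition tw_span (R : {set G}) : {vspace A} :=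
  (\sum_(a in R) <[tw_basis a]>)%VS.

End TwistedGroupAlgebra.

Section Products.
Variables (F : fieldType) (V : lmodType F) (mul : V -> V -> V).

Definition lie_product (x y : V) : V := mul x y - mul y x.
Definition jordan_product (x y : V) : V := 2^-1 *: (mul x y + mul y x).

End Products.

(* The subspaces U of V and W of V' are closed under the products [mu] and
   [mu'], and the algebras (U, mu) and (W, mu') are isomorphic. A linear map
   on U is given by (any) linear extension of it to V. *)
Definition subspace_alg_isom (F : fieldType) (V V' : vectType F)
    (U : {vspace V}) (mu : V -> V -> V)
    (W : {vspace V'}) (mu' : V' -> V' -> V') : Prop :=
  [/\ {in U &, forall x y, mu x y \in U},
      {in W &, forall x y, mu' x y \in W}
    & exists f : 'Hom(V, V'),
        [/\ {in U &, injective f}, (f @: U)%VS = W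
          & {in U &, forall x y, f (mu x y) = mu' (f x) (f y)}]].

Definition sl_space (F : fieldType) (n : nat) : {vspace 'M[F]_n} :=
  lker (linfun (fun x : 'M[F]_n => \tr x : F^o)).

Lemma mem_sl_space (F : fieldType) (n : nat) (x : 'M[F]_n) :
  (x \in sl_space F n) = (\tr x == 0).
Proof.
pose f : {linear 'M[F]_n -> F^o} := @mxtrace F n.
by rewrite memv_ker -[X in linfun X](_ : (f : _ -> _) = _) // lfunE.
Qed.

Definition Lie_isom_sl (F : fieldType) (G : finZmodType) (xi : cocycle2 F G)
    (R : {set G}) (n : nat) : Prop :=
  subspace_alg_isom
    (tw_span xi R) (lie_product (fun x y => x * y))
    (sl_space F n) (lie_product (fun x y => x *m y)).

Definition Jordan_isom_Mplus (F : fieldType) (G : finZmodType)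
    (xi : cocycle2 F G) (R : {set G}) (n : nat) : Prop :=
  subspace_alg_isom
    (tw_span xi R) (jordan_product (fun x y => x * y))
    (fullv : {vspace 'M[F]_n}) (jordan_product (fun x y => x *m y)).

(* Main.v *)
Require Import Defs.
From HB Require Import structures.
From mathcomp Require Import all_boot all_order all_fingroup all_algebra.
From mathcomp Require Import ring.

(** The root system axioms for the nonzero elements and for the whole group are
    immediate, and the first system is indecomposable because a decomposition
    would cover G by two proper subgroups. The substance is the isomorphism of
    the twisted group algebra with M_n(F).

    A maximal isotropic subgroup H is its own orthogonal (lagrangian_exists),
    and summing beta over H x G in both orders gives |H| |H^perp| = |G|
    (card_perp). So |G| = n^2, where n = |H| is also the index of H; this fixes
    n before any cocycle is chosen.

    Now let xi induce beta. On H the cocycle xi is symmetric, so the elements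
    u_h, h in H, act on the twisted group algebra by commuting operators. They
    have a common eigenvector because F is algebraically closed, and its
    eigenvalues form a function chi on H with
    chi a * chi b = xi a b * chi (a + b) (twisted_character_exists). Inducing
    this one-dimensional module from H to G gives a monomial representation
    rho of degree [G : H] = n (twisted_rep_exists).

    By linearity rho extends to an algebra morphism to M_n(F). Comparing the
    traces of the two products of rho h and rho (g - h) shows that rho g has
    trace 0 for g != 0 (tr_twisted_rep), so the trace of the image of x is a
    nonzero multiple of the coefficient x 0. Multiplying by basis elements, the
    traces recover every coefficient of x: the morphism is injective. Both
    algebras have dimension n^2, so it is bijective, and it carries the span of
    the u_g with g != 0, namely the elements x with x 0 = 0, onto the matrices
    of trace 0. *)

Set Implicit Arguments.
Unset Strict Implicit.
Unset Printing Implicit Defensive.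

Import GRing.Theory.
Local Open Scope ring_scope.

(** * Subgroups of a finite additive group *)

Section AdditiveSubgroups.
Variable G : finZmodType.
Implicit Types H : {group G}.

Lemma mem_group0 H : 0 \in H.
Proof. exact: group1. Qed.

Lemma mem_groupD H a b : a \in H -> b \in H -> a + b \in H.
Proof. exact: groupM. Qed.

Lemma mem_groupB H a b : a \in H -> b \in H -> a - b \in H.
Proof. by move=> Ha Hb; apply: mem_groupD => //; rewrite (groupVr Hb). Qed.

Lemma opp_closed_imset (R : {set G}) :
  {in R, forall a, - a \in R} -> [set - a | a in R] = R.
Proof.
move=> RN; apply/setP => a; apply/imsetP/idP => [[b /RN Rb ->]//|/RN Ra].
by exists (- a); rewrite ?opprK.
Qed.

Lemma nonzero_generate : <<[set~ (0 : G)]>>%g = [set: G].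
Proof.
apply/eqP; rewrite eqEsubset subsetT; apply/subsetP => a _.
have [->|a0] := eqVneq a 0; first exact: group1.
by rewrite mem_gen // !inE.
Qed.

(** If x is outside H1 and y is outside H2, then one of x, y, x + y is outside
    both. *)
Lemma proper_subgroups_miss H1 H2 :
    H1 \proper [set: G] -> H2 \proper [set: G] ->
  exists2 x, x \notin H1 & x \notin H2.
Proof.
move=> /properP[_ [x _ H1x]] /properP[_ [y _ H2y]].
have [H2x | ] := boolP (x \in H2); last by exists x.
have [H1y | ] := boolP (y \in H1); last by exists y.
exists (x + y).
  by apply: contra H1x => /mem_groupB/(_ H1y); rewrite addrK.
by apply: contra H2y => /mem_groupB/(_ H2x); rewrite addrC addKr.
Qed.

End AdditiveSubgroups.

(** * Orthogonals and Lagrangian subgroups *)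

Lemma natr_inj_pchar0 (F : fieldType) (m n : nat) :
  [pchar F] =i pred0 -> m%:R = n%:R :> F -> m = n.
Proof.
move=> /pcharf0P F0; wlog le_mn : m n / (m <= n)%N => [IH e|].
  by case/orP: (leq_total m n) => /IH-> //.
move/esym/eqP; rewrite -subr_eq0 -natrB // F0 subn_eq0 => le_nm.
by apply/eqP; rewrite eqn_leq le_mn.
Qed.

Section Orthogonals.
Variables (F : fieldType) (G : finZmodType) (beta : G -> G -> F).
Hypothesis bb : alternating_bicharacter beta.

Lemma bichar0l a : beta 0 a = 1.
Proof.
have := bicharDl bb 0 0 a; rewrite addr0 -{1}[beta 0 a]mulr1.
by move/(mulfI (bichar_neq0 bb _ _)).
Qed.

Lemma bicharC a b : beta a b * beta b a = 1.
Proof.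
have := bichar_alt bb (a + b).
by rewrite (bicharDl bb) !(bicharDr bb) !(bichar_alt bb) mul1r mulr1.
Qed.

Lemma bicharNl_self a : beta (- a) a = 1.
Proof.
have := bicharDl bb (- a) a a.
by rewrite addNr bichar0l (bichar_alt bb) mulr1 => <-.
Qed.

Lemma bichar_eq1C a b : (beta a b == 1) = (beta b a == 1).
Proof.
by apply/eqP/eqP => e; have := bicharC a b; rewrite e ?mul1r ?mulr1.
Qed.

Definition perp (A : {set G}) : {set G} :=
  [set g | [forall a in A, beta g a == 1]].

Lemma perpP (A : {set G}) g :
  reflect {in A, forall a, beta g a = 1} (g \in perp A).
Proof.
by rewrite inE; apply: (iffP forall_inP) => h a Aa; apply/eqP; rewrite h.
Qed.
Arguments perpP {A g}.

Lemma perp_group_set A : group_set (perp A).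
Proof.
apply/group_setP; split=> [|x y /perpP Ax /perpP Ay]; apply/perpP => a Aa.
  exact: bichar0l.
by rewrite [LHS](bicharDl bb) Ax ?Ay ?mulr1.
Qed.
Canonical perp_group A := Group (perp_group_set A).

Lemma sub_perpC (A B : {set G}) : (A \subset perp B) = (B \subset perp A).
Proof.
by apply/subsetP/subsetP => h x Xx; apply/perpP => y Yy; apply/eqP;
  rewrite bichar_eq1C; exact/eqP/(perpP (h y Yy)).
Qed.

Lemma perp_gen (A : {set G}) : perp <<A>>%g = perp A.
Proof.
apply/eqP; rewrite eqEsubset; apply/andP; split.
  apply/subsetP => x /perpP h; apply/perpP => a Aa; apply: h.
  exact: mem_gen.
by rewrite sub_perpC gen_subG sub_perpC.
Qed.

(** Any g orthogonal to a maximal isotropic H is already in H: since beta is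
    alternating, H and g together generate an isotropic subgroup. *)
Lemma lagrangian_exists : exists H : {group G}, perp H = H.
Proof.
have [|H /maxgroupP[isoH maxH]] :=
    @ex_maxgroup _ [pred H : {group G} | H \subset perp H].
  by exists 1%G; rewrite /= sub1G.
rewrite /= in isoH; exists H; apply/eqP; rewrite eqEsubset isoH andbT.
apply/subsetP => g Hg.
suff /(maxH <<g |: H>>%G) <- : <<g |: H>>%g \subset perp <<g |: H>>%g.
- by rewrite mem_gen ?setU11.
- by rewrite -{1}(genGid H) genS ?subsetUr.
rewrite perp_gen gen_subG subUset !sub1set; apply/andP; split.
  apply/perpP => a; rewrite in_setU1 => /predU1P[-> | Ha].
    exact: bichar_alt bb _.
  exact: (perpP Hg).
by rewrite sub_perpC subUset sub1set Hg.
Qed.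

Lemma nonsingular_pairing g :
  nonsingular beta [set: G] -> g != 0 -> exists h, beta h g != 1.
Proof.
move=> ns g0; have: g \notin radical beta [set: G] by rewrite ns inE.
rewrite inE inE /= negb_forall => /existsP[h]; rewrite inE /= => gh.
by exists h; rewrite bichar_eq1C.
Qed.

(** Translating the summation variable by a shows that the sum is invariant
    under multiplication by phi a, for each a in K. *)
Lemma sum_character (K : {group G}) (phi : G -> F) :
  {in K &, forall a b, phi (a + b) = phi a * phi b} ->
  \sum_(k in K) phi k = (#|K| * [forall k in K, phi k == 1])%:R.
Proof.
move=> phiM; case: forall_inP => [phi1 | /forall_inP].
  by rewrite muln1 -sumr_const; apply: eq_bigr => k /phi1/eqP.
rewrite negb_forall => /existsP[a]; rewrite negb_imply => /andP[Ka phia].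
rewrite muln0; apply/eqP; have: (phi a - 1) * \sum_(k in K) phi k == 0.
  rewrite mulrBl mul1r mulr_sumr subr_eq0; apply/eqP.
  rewrite [RHS](reindex_inj (addrI a)) /=; apply: eq_big => k.
    apply/idP/idP => [/(mem_groupD Ka) // |].
    by move/mem_groupB/(_ Ka); rewrite addrC addKr.
  by move=> Kk; rewrite phiM.
by rewrite mulf_eq0 subr_eq0 (negbTE phia).
Qed.

(** Double counting: by nonsingularity the character beta h of G is trivial
    only for h = 0, while the character beta^~ g is trivial on H exactly when
    g is in perp H. Characteristic 0 turns the equality of the two sums in F
    into one of natural numbers. *)
Lemma card_perp (H : {group G}) : [pchar F] =i pred0 ->
  nonsingular beta [set: G] -> (#|H| * #|perp H|)%N = #|G|.
Proof.
move=> charF0 ns.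
have perpT h : [forall g in [set: G]%G, beta h g == 1] = (h == 0).
  by move/setP: ns => /(_ h); rewrite !inE.
apply: natr_inj_pchar0 (charF0) _.
transitivity (\sum_(g : G) \sum_(h in H) beta h g).
  rewrite mulnC natrM mulr_natl -sumr_const big_mkcond.
  apply: eq_bigr => g _; rewrite (sum_character (phi := beta^~ g)); last first.
    by move=> a b _ _; apply: bicharDl bb _ _ _.
  rewrite inE; under eq_forallb do rewrite bichar_eq1C.
  by case: ifP => _; rewrite ?muln1 ?muln0.
rewrite exchange_big /= (bigD1 0) ?mem_group0 //=.
rewrite [X in _ + X]big1 => [|h /andP[_ h0]].
  under eq_bigr do rewrite bichar0l.
  by rewrite sumr_const addr0.
transitivity (\sum_(g in [set: G]%G) beta h g).
  by apply: eq_bigl => g; rewrite inE.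
rewrite sum_character; last by move=> a b _ _; apply: bicharDr bb _ _ _.
by rewrite perpT (negbTE h0) muln0.
Qed.

End Orthogonals.
Arguments perpP {F G beta A g}.

(** * Common eigenvectors *)

(** Letting W vary makes the induction on the list work: W is cut down to its
    intersection with an eigenspace of the first operator, which the others
    preserve because they commute with it. *)
Lemma common_eigenvector_in (F : closedFieldType) n (W : 'M[F]_n)
    (As : seq 'M[F]_n) :
  W != 0 -> {in As, forall A, stablemx W A} ->
  {in As &, forall A B, comm_mx A B} ->
  exists2 v : 'rV_n, (v != 0) && (v <= W)%MS &
    {in As, forall A, stablemx v A}.
Proof.
elim: As W => [|A As IH] W W0 stW comA.
  by have /rowV0Pn[v vW v0] := W0; exists v; rewrite ?v0.
(* B is the matrix of the restriction of A to W, in the basis U of W. *)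
pose U := row_base W; pose B := U *m A *m pinvmx U.
have BU : B *m U = U *m A.
  rewrite mulmxKpV // (eqmxMr A (eq_row_base W)) eq_row_base.
  by apply: stW; rewrite mem_head.
have /closed_rootP[a] : size (char_poly B) != 1%N.
  by rewrite size_char_poly eqSS mxrank_eq0.
rewrite -eigenvalue_root_char => /eigenvalueP[u uB u0].
have [|||v /andP[v0 vW'] stv] := IH (W :&: eigenspace A a)%MS.
- apply/rowV0Pn; exists (u *m U); last by rewrite mulmx_free_eq0 ?row_base_free.
  rewrite sub_capmx -{1}(eq_row_base W) submxMl; apply/eigenspaceP.
  by rewrite -mulmxA -BU mulmxA uB -scalemxAl.
- move=> C AsC; rewrite sub_capmx; apply/andP; split.
    apply: submx_trans (stW C _); last by rewrite inE AsC orbT.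
    by rewrite submxMr ?capmxSl.
  have AC : comm_mx A C by apply: comA; rewrite inE ?AsC ?eqxx ?orbT.
  apply: submx_trans (comm_mx_stable_eigenspace a AC).
  by rewrite submxMr ?capmxSr.
- by move=> C D sC sD; apply: comA; rewrite inE ?sC ?sD orbT.
move: vW'; rewrite sub_capmx => /andP[vW vA].
exists v => [|C]; first by rewrite v0.
rewrite inE => /predU1P[-> | /stv //].
by rewrite (eigenspaceP vA) scalemx_sub.
Qed.

(** * The representation induced from a twisted character *)

Section TwistedRepresentations.
Variables (F : closedFieldType) (G : finZmodType) (xi : cocycle2 F G).

(** In cohomological terms: a symmetric cocycle on H with values in the
    divisible group F^x is a coboundary. *)
Lemma twisted_character_exists (H : {group G}) :
  {in H &, forall a b, xi a b = xi b a} ->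
  exists2 chi : G -> F, chi 0 = xi 0 0 &
    {in H &, forall a b, chi a * chi b = xi a b * chi (a + b)}.
Proof.
move=> xiC.
(* M a is left multiplication by u_a in the twisted group algebra, acting on
   row vectors: it maps e_g to xi a g e_(a + g). *)
pose M a : 'M[F]_#|G| :=
  \matrix_(i, j) (xi a (enum_val i) *+ (enum_val j == a + enum_val i)).
have MM a b : M a *m M b = xi b a *: M (b + a).
  apply/matrixP => i j; rewrite !mxE (bigD1 (enum_rank (a + enum_val i))) //=.
  rewrite big1 ?addr0 => [|k ki]; rewrite !mxE; last first.
    rewrite -(inj_eq enum_rank_inj) enum_valK (negbTE ki).
    by rewrite mul0r.
  rewrite enum_rankK eqxx mulr1n addrA mulrnAr mulrnAr.
  by rewrite (cocycleP xi) mulrC.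
have M0 : M 0 = (xi 0 0)%:M.
  apply/matrixP => i j; rewrite !mxE tw_cocycle0l add0r eq_sym.
  by rewrite (inj_eq enum_val_inj).
have [|||v /andP[v0 _] stv] :=
    @common_eigenvector_in F _ 1%:M [seq M a | a <- enum H].
- by rewrite -mxrank_eq0 mxrank1 -lt0n; apply/card_gt0P; exists 0.
- by move=> A _; apply: submx1.
- by move=> _ _ /mapP[a + ->] /mapP[b + ->]; rewrite !mem_enum => Ha Hb;
    rewrite /comm_mx !MM addrC xiC.
have /rV0Pn[i vi] := v0.
(* The eigenvalue of M a on v, read off at a nonzero coordinate of v. *)
pose chi a := (v *m M a) 0 i / v 0 i.
have vM a : a \in H -> v *m M a = chi a *: v.
  move=> Ha; have /stv/sub_rVP[c e] : M a \in [seq M a | a <- enum H].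
    by rewrite map_f ?mem_enum.
  by rewrite /chi e mxE mulfK.
exists chi => [|a b Ha Hb].
  by rewrite /chi M0 mul_mx_scalar mxE mulfK.
have: v *m (M a *m M b) = (chi a * chi b) *: v.
  by rewrite mulmxA vM // -scalemxAl vM // scalerA.
rewrite MM -scalemxAr addrC vM ?mem_groupD // scalerA xiC //.
by move/rowP/(_ i); rewrite !mxE => /(mulIf vi) ->.
Qed.

(** Labels the cosets of H by the ordinals that index the rows and columns of
    the induced representation: r picks representatives, c reads off labels. *)
Lemma coset_section (H : {group G}) :
  exists (r : 'I_#|[set: G]%G : H|%g -> G) (c : G -> 'I_#|[set: G]%G : H|%g),
  (forall g, g - r (c g) \in H) /\ (forall g i, g - r i \in H -> c g = i).
Proof.
have cosetG g : (H :* g)%g \in rcosets H [set: G].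
  by rewrite mem_rcosets (subsetP (mulG_subr _ _)) ?inE.
exists (fun i => repr (enum_val i)).
exists (fun g => enum_rank_in (cosetG 0) (H :* g)%g).
split=> [g | g i Hgi].
  rewrite enum_rankK_in //.
  have := mem_repr_rcoset H g; rewrite mem_rcoset => /groupVr.
  by rewrite FinRing.zmodVgE FinRing.zmodMgE opprD opprK addrC.
rewrite -[RHS](enum_valK_in (cosetG 0)); congr enum_rank_in.
have /rcosetsP[x _ e] := enum_valP i; rewrite e in Hgi *.
by rewrite -(rcoset_repr H x); apply/rcoset_eqP; rewrite mem_rcoset.
Qed.

(** A module over the twisted group algebra, given by the action of the basis
    elements. *)
Definition twisted_rep (n : nat) (rho : G -> 'M[F]_n) :=
  rho 0 = (xi 0 0)%:M /\
  forall a b, rho a *m rho b = xi a b *: rho (a + b).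

(** If w spans a line on which u_h acts as chi h for h in H, the induced module
    has basis u_(r j) w, and u_g u_(r j) w = t g i j *: u_(r i) w, where r i
    represents the coset of g + r j. *)
Lemma twisted_rep_exists (H : {group G}) :
  {in H &, forall a b, xi a b = xi b a} ->
  exists rho : G -> 'M[F]_#|[set: G]%G : H|%g, twisted_rep rho.
Proof.
move=> /twisted_character_exists[chi chi0 chiM].
have [r [c [cP cU]]] := coset_section H.
have cE x y : x - y \in H -> c x = c y.
  move=> Hxy; apply: cU.
  by have := mem_groupD Hxy (cP y); rewrite addrA subrK.
pose t g i j := let h := g + r j - r i in xi g (r j) / xi (r i) h * chi h.
exists (fun g => \matrix_(i, j) (t g i j *+ (i == c (g + r j)))); split.
  apply/matrixP => i j; rewrite !mxE add0r.
  have -> : c (r j) = j by apply: cU; rewrite subrr mem_group0.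
  case: eqVneq => // ->; rewrite /t add0r subrr tw_cocycle0l tw_cocycle0r chi0.
  by rewrite mulfV ?mul1r ?cocycle_neq0.
move=> a b; apply/matrixP => i j; rewrite !mxE.
set k := c (b + r j).
rewrite (bigD1 k) //= big1 ?addr0 => [|l /negbTE lk]; rewrite !mxE; last first.
  by rewrite lk mulr0.
rewrite eqxx mulr1n.
have -> : c (a + b + r j) = c (a + r k).
  by apply: cE; rewrite -[a + b + _]addrA opprD addrACA subrr add0r cP.
case: eqP => [->|_]; last by rewrite mul0r mulr0.
rewrite !mulr1n /t; set l := c (a + r k).
set h := b + r j - r k; set h' := a + r k - r l.
have Hh : h \in H := cP _.
have Hh' : h' \in H := cP _.
have Ek : r k + h = b + r j by rewrite addrC subrK.
have El : r l + h' = a + r k by rewrite addrC subrK.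
have -> : a + b + r j - r l = h' + h.
  rewrite -[a + b + _]addrA -Ek addrA -El -[r l + h' + h]addrA.
  by rewrite [r l + _]addrC addrK.
(* The equality of the coefficients combines three instances of the cocycle
   identity with the multiplicativity of chi. *)
have e1 := cocycleP xi a b (r j).
have e2 := cocycleP xi a (r k) h.
have e3 := cocycleP xi (r l) h' h.
rewrite Ek in e2; rewrite El in e3.
have e4 := chiM _ _ Hh' Hh.
have xi0 := cocycle_neq0 xi.
have -> : xi a (r k) = xi (r k) h * xi a (b + r j) / xi (a + r k) h.
  by rewrite -e2 mulfK.
have -> : xi (r l) h' = xi h' h * xi (r l) (h' + h) / xi (a + r k) h.
  by rewrite -e3 mulfK.
transitivity (xi b (r j) * xi a (b + r j) / xi (r l) (h' + h) *
   (chi h' * chi h / xi h' h)).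
  by field; rewrite !xi0.
by rewrite -e1 e4; field; rewrite !xi0.
Qed.

End TwistedRepresentations.

(** * The isomorphism with the matrix algebra *)

Lemma mem_tw_span (F : fieldType) (G : finZmodType) (xi : cocycle2 F G)
    (R : {set G}) (x : twisted_group_algebra xi) :
  reflect (forall g, g \notin R -> x g = 0) (x \in tw_span xi R).
Proof.
apply: (iffP memv_sumP) => [[y yP ->] g Rg | xP].
  rewrite sum_ffunE big1 // => a Ra.
  have /vlineP[k ->] := yP a Ra; rewrite !ffunE.
  by case: eqP Rg => [->|_ _]; rewrite ?Ra ?scaler0.
exists (fun a => x a *: tw_basis xi a) => [a _|].
  by apply/vlineP; exists (x a).
apply/ffunP => g; rewrite sum_ffunE.
have [Rg|/[dup] Rg /xP ->] := boolP (g \in R).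
  rewrite (bigD1 g) //= big1 ?addr0 => [|a /andP[_ ag]]; rewrite !ffunE.
    by rewrite eqxx [RHS]mulr1.
  by rewrite eq_sym (negbTE ag) scaler0.
rewrite big1 // => a Ra; rewrite !ffunE.
by case: eqP Rg => [->|_ _]; rewrite ?Ra ?scaler0.
Qed.

Section MatrixIsomorphism.
Variables (F : closedFieldType) (G : finZmodType) (xi : cocycle2 F G).
Variables (beta : G -> G -> F) (n : nat) (rho : G -> 'M[F]_n).
Hypothesis charF0 : [pchar F] =i pred0.
Hypothesis bb : alternating_bicharacter beta.
Hypothesis ns : nonsingular beta [set: G].
Hypothesis xiB : cocycle_induces xi beta.
Hypothesis rhoP : twisted_rep xi rho.
Hypothesis cardG : #|G| = (n ^ 2)%N.
Local Notation A := (twisted_group_algebra xi).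

(** If beta h g != 1, then rho h *m rho (g - h) and rho (g - h) *m rho h have
    the same trace, but they are multiples of rho g by distinct scalars. *)
Lemma tr_twisted_rep g : g != 0 -> \tr (rho g) = 0.
Proof.
move=> /(nonsingular_pairing bb ns)[h hg].
have := mxtrace_mulC (rho h) (rho (g - h)).
rewrite !rhoP.2 !mxtraceZ [h + _]addrC !subrK => /eqP.
rewrite -subr_eq0 -mulrBl mulf_eq0 => /orP[|/eqP //].
have e : xi h (g - h) = beta h g * xi (g - h) h.
  rewrite -[X in beta h X](subrK h) (bicharDr bb) (bichar_alt bb) mulr1 -xiB.
  by rewrite mulfVK ?cocycle_neq0.
by rewrite e -{2}[xi _ h]mul1r -mulrBl mulf_eq0 subr_eq0 (negbTE hg)
  (negbTE (cocycle_neq0 _ _ _)).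
Qed.

Lemma degree_neq0 : n%:R != 0 :> F.
Proof.
have /pcharf0P -> := charF0.
have : (0 < n ^ 2)%N; last by rewrite expn_gt0 orbF lt0n.
by rewrite -cardG; apply/card_gt0P; exists 0.
Qed.

Definition rep_ext (x : A) : 'M[F]_n := \sum_g x g *: rho g.

Lemma rep_ext_linear : linear rep_ext.
Proof.
move=> k x y; rewrite /rep_ext scaler_sumr -big_split; apply: eq_bigr => g _.
by rewrite !ffunE scalerDl scalerA.
Qed.
HB.instance Definition _ :=
  GRing.isLinear.Build F A 'M[F]_n _ rep_ext rep_ext_linear.

Lemma rep_extM x y : rep_ext (x * y) = rep_ext x *m rep_ext y.
Proof.
rewrite /rep_ext mulmx_suml.
under eq_bigr => c _ do rewrite ffunE scaler_suml.
rewrite exchange_big; apply: eq_bigr => a _ /=.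
rewrite mulmx_sumr (reindex_inj (addrI a)); apply: eq_bigr => b _ /=.
rewrite [a + b - a]addrC addKr -scalemxAl -scalemxAr rhoP.2 !scalerA.
by [].
Qed.

Lemma tr_rep_ext x : \tr (rep_ext x) = n%:R * xi 0 0 * x 0 :> F.
Proof.
rewrite /rep_ext raddf_sum (bigD1 0) //= big1 => [|g g0].
  by rewrite addr0 mxtraceZ rhoP.1 mxtrace_scalar mulr_natl mulrC.
by rewrite mxtraceZ tr_twisted_rep ?mulr0.
Qed.

Lemma tr_rep_ext_eq0 x : (\tr (rep_ext x) == 0) = (x 0 == 0).
Proof.
by rewrite tr_rep_ext !mulf_eq0 (negbTE degree_neq0)
  (negbTE (cocycle_neq0 _ _ _)).
Qed.

(** The coefficient x g is, up to a nonzero scalar, the trace of the image of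
    x * u_(- g). *)
Lemma rep_ext_inj : injective rep_ext.
Proof.
apply: raddf_inj => x x0; apply/ffunP => g; rewrite [RHS]ffunE.
have: \tr (rep_ext (x * tw_basis xi (- g))) = 0.
  by rewrite rep_extM x0 mul0mx mxtrace0.
move/eqP; rewrite tr_rep_ext_eq0 ffunE (bigD1 g) //= big1 => [|a ag].
  rewrite !ffunE sub0r eqxx mulr1 addr0 mulf_eq0.
  by rewrite (negbTE (cocycle_neq0 _ _ _)) orbF => /eqP.
by rewrite ffunE sub0r (inj_eq oppr_inj) (negbTE ag) mulr0 mul0r.
Qed.

Definition rep_hom : 'Hom(A, 'M[F]_n) := linfun rep_ext.

Lemma rep_homE x : rep_hom x = rep_ext x.
Proof. exact: lfunE. Qed.

Lemma rep_hom_inj : injective rep_hom.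
Proof. by move=> x y; rewrite !rep_homE => /rep_ext_inj. Qed.

Lemma rep_hom_surj : limg rep_hom = fullv.
Proof.
apply/eqP; rewrite eqEdim subvf limg_dim_eq; last first.
  by rewrite capfv; apply/eqP/lker0P/rep_hom_inj.
rewrite !dimvf dim_matrix /dim /=.
rewrite muln1 cardG; exact: leqnn.
Qed.

Lemma Jordan_isom : Jordan_isom_Mplus xi [set: G] n.
Proof.
have fullG : tw_span xi [set: G] = fullv.
  apply/vspaceP => x; rewrite memvf; apply/mem_tw_span => g.
  by rewrite inE.
rewrite /Jordan_isom_Mplus fullG; split=> [x y _ _|x y _ _|]; rewrite ?memvf //.
exists rep_hom; split=> [x y _ _||x y _ _].
- exact: rep_hom_inj.
- exact: rep_hom_surj.
by rewrite !rep_homE /jordan_product linearZ linearD /= !rep_extM.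
Qed.

Lemma Lie_isom : Lie_isom_sl xi [set~ 0] n.
Proof.
have spanE x : (x \in tw_span xi [set~ 0]) = (rep_hom x \in sl_space F n).
  rewrite rep_homE mem_sl_space tr_rep_ext_eq0.
  apply/mem_tw_span/eqP => [h | x0 g]; first by apply: h; rewrite !inE eqxx.
  by rewrite !inE negbK => /eqP->.
have homL x y : rep_hom (lie_product (fun x y => x * y) x y) =
    lie_product (fun x y => x *m y) (rep_hom x) (rep_hom y).
  by rewrite !rep_homE /lie_product linearB /= !rep_extM.
have slL (x y : 'M[F]_n) : lie_product (fun x y => x *m y) x y \in sl_space F n.
  by rewrite mem_sl_space /lie_product linearB /= mxtrace_mulC subrr.
split=> [x y _ _|x y _ _|]; rewrite ?spanE ?homL //.
exists rep_hom; split=> [x y _ _||x y _ _].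
- exact: rep_hom_inj.
- apply/vspaceP => y; apply/memv_imgP/idP => [[x xS ->]|yS].
    by rewrite -spanE.
  have /memv_imgP[x _ yx] : y \in limg rep_hom by rewrite rep_hom_surj memvf.
  by exists x; rewrite ?spanE -?yx.
- exact: homL.
Qed.

End MatrixIsomorphism.

Theorem proposition5p1 (F : closedFieldType) (charF0 : [pchar F] =i pred0)
    (G : finZmodType) (beta : G -> G -> F)
    (beta_bichar : alternating_bicharacter beta)
    (beta_nonsing : nonsingular beta [set: G]%G)
    (G_nontriv : (1 < #|G|)%N) :
  exists n : nat, #|G| = (n ^ 2)%N /\
    [/\ reduced_skew_root_Lie beta [set: G]%G [set~ 0],
        indecomposable_skew_root_Lie beta [set: G]%G [set~ 0]
      & forall xi : cocycle2 F G, cocycle_induces xi beta ->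
          Lie_isom_sl xi [set~ 0] n] /\
    (reduced_skew_root_Jordan beta [set: G]%G [set: G] /\
     forall xi : cocycle2 F G, cocycle_induces xi beta ->
       Jordan_isom_Mplus xi [set: G] n).
Proof.
have [H perpH] := lagrangian_exists beta_bichar.
have cardH : #|[set: G]%G : H|%g = #|H|.
  apply/eqP; rewrite -(eqn_pmul2l (cardG_gt0 H)) Lagrange ?subsetT // cardsT.
  by rewrite -(card_perp beta_bichar H) // perpH.
exists #|[set: G]%G : H|%g.
have cardG : #|G| = (#|[set: G]%G : H|%g ^ 2)%N.
  by rewrite cardH -(card_perp beta_bichar H) // perpH expnS expn1.
have repH xi : cocycle_induces xi beta ->
    exists rho : G -> 'M[F]_#|[set: G]%G : H|%g, twisted_rep xi rho.
  move=> xiB; apply: twisted_rep_exists => a b Ha Hb.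
  rewrite -perpH in Ha; have := xiB a b; rewrite (perpP Ha) //.
  by move/(canRL (mulfVK (cocycle_neq0 _ _ _))); rewrite mul1r.
have sr0 : skew_root_Lie beta [set: G]%G [set~ 0].
  split.
  - rewrite beta_nonsing; apply: contraTneq G_nontriv => e.
    by rewrite -cardsT -e cards1.
  - by rewrite beta_nonsing setTD.
  - exact: nonzero_generate.
  - by apply: opp_closed_imset => a; rewrite !inE oppr_eq0.
  move=> a b _ _; rewrite !inE; apply: contraNneq => /eqP.
  by rewrite addr_eq0 => /eqP->; rewrite (bicharNl_self beta_bichar).
split=> //; split; split=> //.
- split=> // -[H1 [H2 [R1 [R2 [[_ pr1 pr2 _] [eR _ sr1 sr2]]]]]].
  have [x H1x H2x] := proper_subgroups_miss pr1 pr2.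
  have: x \in [set~ 0].
    by rewrite !inE; apply: contraNneq H1x => ->; apply: mem_group0.
  rewrite eR => /setUP[/(subsetP (skewL_sub sr1)) | /(subsetP (skewL_sub sr2))].
    by case/setDP; rewrite (negbTE H1x).
  by case/setDP; rewrite (negbTE H2x).
- move=> xi xiB; have [rho rhoP] := repH xi xiB.
  exact: Lie_isom charF0 beta_bichar beta_nonsing xiB rhoP cardG.
- split=> //; split=> //; last by move=> a b _ _ _; rewrite inE.
  + by apply/set0Pn; exists 0.
  + by rewrite (genGid [set: G]%G).
  + by apply: opp_closed_imset => a; rewrite !inE.
- move=> xi xiB; have [rho rhoP] := repH xi xiB.
  exact: Jordan_isom charF0 beta_bichar beta_nonsing xiB rhoP cardG.
Qed.
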